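(* In the folding setting described in the context: (1) For all $\alpha^\vee\in Q^\vee_A$ and $\lambda\in P'_A$, $\langle\varphi(\alpha^\vee),\psi(\lambda)\rangle=\kappa\,\langle\alpha^\vee,\lambda\rangle$. (2) For all $\Lambda\in P'_A$ and $w\in W_A$, $\psi(w\Lambda)=f(w)\psi(\Lambda)$. (3) For all $w\in W_A$, $\Lambda\in P'_A$ and $\alpha^\vee\in Q_A^\vee$, $\langle\varphi(\alpha^\vee),f(w)\psi(\Lambda)\rangle=\kappa\langle\alpha^\vee,w\Lambda\rangle$; in particular, for $i\in I$, $\langle\tilde\beta_i^\vee,f(w)\psi(\Lambda)\rangle=\kappa\langle\alpha_i^\vee,w\Lambda\rangle$, where $\tilde\beta_i^\vee=\sum_{j\in O_i}\beta_j^\vee$. (4) The map $\varphi$ sends $Q^\vee_A\cap Z(\mathfrak{g}(A))$ into $Z(\mathfrak{g}(B))$.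
   Context: Let $B=(b_{jk})_{j,k\in J}$ be a generalized Cartan matrix (GCM) and $\pi$ a permutation of $J$ with $b_{\pi(j)\pi(k)}=b_{jk}$ for all $j,k$, which is admissible: $b_{jk}=0$ whenever $j,k$ lie in the same $\pi$-orbit. Let $I$ index the $\pi$-orbits, $O_i\subset J$ the orbit indexed by $i$, $o_i=|O_i|$, and let $A=(a_{i'i})_{i',i\in I}$ be the GCM given by $a_{i'i}=\frac{o_{i'}}{o_i}\sum_{j\in O_i}b_{j'j}$ for any $j'\in O_{i'}$. For $\mathfrak{g}(A)$ let $\alpha_i,\alpha_i^\vee,\Lambda_i$ be the simple roots, simple coroots, fundamental weights and $W_A$ the Weyl group with generators $s_i^A$; for $\mathfrak{g}(B)$ let $\beta_j,\beta_j^\vee,\omega_j$ and $W_B$ with generators $s_j^B$ be the analogous data. $Q^\vee_A,Q^\vee_B$ are the coroot lattices. $P'_A$ is the weight lattice of $\mathfrak{g}(A)$ modulo the annihilator of all the $\alpha_i^\vee$ (so the pairing with coroots and the $W_A$-action descend to it), similarly $P'_B$; $\alpha_i,\Lambda_i$ etc. also denote their images. Let $\kappa=\mathrm{lcm}_{i\in I}(o_i)$. Define $\psi:P'_A\to P'_B$ linearly by $\psi(\Lambda_i)=\frac{\kappa}{o_i}\sum_{j\in O_i}\omega_j$ and $\varphi:Q^\vee_A\to Q^\vee_B$ by $\varphi(\alpha_i^\vee)=\sum_{j\in O_i}\beta_j^\vee$. Let $f:W_A\to W_B$ be the group homomorphism with $f(s_i^A)=\prod_{j\in O_i}s_j^B$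 (the factors commute by admissibility; $f$ is a well-defined injective homomorphism). $Z(\mathfrak{g})$ denotes the center. *)

(* Defs.v *)
From HB Require Import structures.
From mathcomp Require Import all_boot all_order perm all_algebra.
From mathcomp Require Import boolp.

Set Implicit Arguments.
Unset Strict Implicit.
Unset Printing Implicit Defensive.

Import GRing.Theory.
Local Open Scope ring_scope.
Local Open Scope quotient_scope.

Record gcm (I : finType) := Gcm {
  gcm_entry :> I -> I -> int;
  gcm_diag : forall i, gcm_entry i i = 2;
  gcm_offdiag : forall i k, i != k -> gcm_entry i k <= 0;
  gcm_zero : forall i k, gcm_entry i k = 0 -> gcm_entry k i = 0
}.

Definition gcm_automorphism (J : finType) (B : gcm J) (pi : {perm J}) : Prop :=
  forall j k, B (pi j) (pi k) = B j k.

(* Only distinct elements of an orbit are meant, since b_jj = 2.               *)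
Definition admissible (J : finType) (B : gcm J) (pi : {perm J}) : Prop :=
  forall j k, k \in porbit pi j -> k != j -> B j k = 0.

Definition indexes_orbits (I J : finType) (pi : {perm J}) (O : I -> {set J}) :
    Prop :=
  injective O /\ [set O i | i : I] = porbits pi.

Definition is_folding (I J : finType) (B : gcm J) (O : I -> {set J})
    (A : gcm I) : Prop :=
  forall i' i j', j' \in O i' ->
    (A i' i)%:~R
      = #|O i'|%:R / #|O i|%:R * \sum_(j in O i) (B j' j)%:~R :> rat.

Definition orbit_lcm (I J : finType) (O : I -> {set J}) : nat :=
  \big[lcmn/1%N]_(i : I) #|O i|.

Section Realization.

Variables (K : fieldType) (I : finType) (A : gcm I).

Definition gcm_mx : 'M[K]_#|I| :=
  \matrix_(i, k) (A (enum_val i) (enum_val k))%:~R.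

(* Kac's realization of A: <coroot i, simple_root k> = a_ik, both families are        *)
(* linearly independent, and dim h = 2 n - rank A.                             *)
Record realization := Realization {
  cartan : vectType K;
  coroot : I -> cartan;
  simple_root : I -> 'Hom(cartan, K^o);
  coroot_free : free (codom coroot);
  root_free : free (codom simple_root);
  root_coroot : forall i k, simple_root k (coroot i) = (A i k)%:~R;
  dim_cartan : \dim {: cartan} = (2 * #|I| - \rank gcm_mx)%N
}.

End Realization.

Arguments realization K {I} A.

Section LieAlgebra.

Variable K : fieldType.

Record lie_algebra := LieAlgebra {
  lie_sort :> lmodType K;
  bracket : lie_sort -> lie_sort -> lie_sort;
  bracket_linear_l : forall y, linear (bracket^~ y);
  bracket_linear_r : forall x, linear (bracket x);
  bracket_xx : forall x, bracket x x = 0;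
  bracket_jacobi : forall x y z,
    bracket x (bracket y z) + bracket y (bracket z x) + bracket z (bracket x y)
      = 0
}.

Variable g : lie_algebra.

Definition is_subspace (S : g -> Prop) : Prop :=
  S 0 /\ forall (a : K) (x y : g), S x -> S y -> S (a *: x + y).

Definition is_subalgebra (S : g -> Prop) : Prop :=
  is_subspace S /\ forall x y, S x -> S y -> S (bracket x y).

Definition is_ideal (S : g -> Prop) : Prop :=
  is_subspace S /\ forall x y, S y -> S (bracket x y).

Definition lie_center (z : g) : Prop := forall x, bracket z x = 0.

End LieAlgebra.

(* The Kac-Moody algebra g(A), i.e. the Lie algebra generated by h, e_i, f_i   *)
(* with the relations below, modulo the largest ideal meeting h trivially. It  *)
(* is given here by the properties that determine it up to isomorphism         *)
(* [Kac, Infinite dimensional Lie algebras, Prop. 1.4].                        *)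
Record kac_moody (K : fieldType) (I : finType) (A : gcm I)
    (R : realization K A) := KacMoody {
  km_lie :> lie_algebra K;
  km_h : {linear cartan R -> km_lie};
  km_e : I -> km_lie;
  km_f : I -> km_lie;
  km_h_inj : injective km_h;
  km_hh : forall h h', bracket (km_h h) (km_h h') = 0;
  km_ef : forall i k,
    bracket (km_e i) (km_f k) = if i == k then km_h (coroot R i) else 0;
  km_he : forall h i, bracket (km_h h) (km_e i) = simple_root R i h *: km_e i;
  km_hf : forall h i, bracket (km_h h) (km_f i) = - simple_root R i h *: km_f i;
  km_gen : forall S : km_lie -> Prop, is_subalgebra S ->
    (forall h, S (km_h h)) -> (forall i, S (km_e i)) -> (forall i, S (km_f i)) ->
    forall x, S x;
  km_ideal : forall S : km_lie -> Prop, is_ideal S ->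
    (forall h, S (km_h h) -> h = 0) -> forall x, S x -> x = 0
}.

Section Lattices.

Variables (K : fieldType) (I : finType) (A : gcm I).
Variable R : realization K A.

Definition in_coroot_lattice : {pred cartan R} := fun x =>
  `[< exists c : I -> int, x = \sum_i coroot R i *~ c i >].

Lemma in_coroot_lattice_zmod : zmod_closed in_coroot_lattice.
Proof.
split=> [|x y /asboolP[c ->] /asboolP[d ->]]; apply/asboolP.
  by exists (fun=> 0); rewrite big1 // => i _; rewrite mulr0z.
exists (fun i => c i - d i); rewrite -sumrB; apply: eq_bigr => i _.
by rewrite mulrzBr.
Qed.

HB.instance Definition _ :=
  GRing.isZmodClosed.Build (cartan R) in_coroot_lattice in_coroot_lattice_zmod.

Record coroot_lattice := CorootLattice {
  coroot_lattice_val : cartan R;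
  _ : coroot_lattice_val \in in_coroot_lattice }.

HB.instance Definition _ := [isSub for coroot_lattice_val].
HB.instance Definition _ := [Choice of coroot_lattice by <:].
HB.instance Definition _ := [SubChoice_isSubZmodule of coroot_lattice by <:].

Lemma coroot_in_lattice i : coroot R i \in in_coroot_lattice.
Proof.
apply/asboolP; exists (fun k => (k == i)%:Z); rewrite (bigD1 i) //= eqxx mulr1z.
by rewrite big1 ?addr0 // => k /negPf ->; rewrite mulr0z.
Qed.

Definition simple_coroot i : coroot_lattice := CorootLattice (coroot_in_lattice i).

Definition is_weight : {pred 'Hom(cartan R, K^o)} := fun l =>
  `[< forall i, exists z : int, l (coroot R i) = z%:~R >].

Lemma is_weight_zmod : zmod_closed is_weight.
Proof.
split=> [|l m /asboolP hl /asboolP hm]; apply/asboolP=> i.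
  by exists 0; rewrite zero_lfunE.
have [[a la] [b mb]] := (hl i, hm i).
by exists (a - b); rewrite add_lfunE opp_lfunE la mb mulrzBr.
Qed.

HB.instance Definition _ :=
  GRing.isZmodClosed.Build 'Hom(cartan R, K^o) is_weight is_weight_zmod.

Record weight := Weight {
  weight_val : 'Hom(cartan R, K^o);
  _ : weight_val \in is_weight }.

HB.instance Definition _ := [isSub for weight_val].
HB.instance Definition _ := [Choice of weight by <:].
HB.instance Definition _ := [SubChoice_isSubZmodule of weight by <:].

Definition coroot_annihilator : {pred weight} := fun l =>
  [forall i, weight_val l (coroot R i) == 0].

Lemma coroot_annihilator_zmod : zmod_closed coroot_annihilator.
Proof.
split=> [|l m /forallP hl /forallP hm]; apply/forallP=> i.
  by rewrite zero_lfunE.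
by rewrite add_lfunE opp_lfunE /= (eqP (hl i)) (eqP (hm i)) subr0.
Qed.

HB.instance Definition _ :=
  GRing.isZmodClosed.Build weight coroot_annihilator coroot_annihilator_zmod.

(* The lattice P' = P / {l | <coroot i, l> = 0 for all i}.                     *)
Definition weight' := Quotient.quot coroot_annihilator.
HB.instance Definition _ := GRing.Zmodule.on weight'.

Definition to_weight' (l : weight) : weight' := \pi_(Quotient.quot _) l.

Lemma to_weight'P (l m : weight) :
  reflect (forall i, weight_val l (coroot R i) = weight_val m (coroot R i))
          (to_weight' l == to_weight' m).
Proof.
rewrite -Quotient.idealrBE.
apply: (iffP forallP) => h i; last by rewrite add_lfunE opp_lfunE /= h subrr.
by apply/eqP; rewrite -subr_eq0; have := h i; rewrite add_lfunE opp_lfunE.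
Qed.

(* <x, l> for x in the coroot lattice and l in P'; independent of the          *)
(* representative of l by pairingE.                                            *)
Definition pairing (x : coroot_lattice) (l : weight') : K :=
  weight_val (repr l) (coroot_lattice_val x).

Lemma pairingE x l :
  pairing x (to_weight' l) = weight_val l (coroot_lattice_val x).
Proof.
rewrite /pairing; set m := repr _.
have /eqP/to_weight'P hm : to_weight' m = to_weight' l by exact: reprK.
case: x => x /= /asboolP[c ->]; rewrite !linear_sum; apply: eq_bigr => i _.
by rewrite !raddfMz /= hm.
Qed.

Definition is_fundamental (L : I -> weight) : Prop :=
  forall i k, weight_val (L i) (coroot R k) = (k == i)%:R.

End Lattices.

Section Weyl.

Variables (K : fieldType) (I : finType) (A : gcm I).
Variable R : realization K A.
Local Notation dual := 'Hom(cartan R, K^o).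
Implicit Types (l : dual) (w : 'End(dual)).

Definition refl_fun (i : I) l : dual := l - l (coroot R i) *: simple_root R i.

Lemma refl_fun_linear i : linear (refl_fun i).
Proof.
move=> a l m; rewrite /refl_fun add_lfunE scale_lfunE scalerDl scalerBr scalerA.
by rewrite opprD addrACA.
Qed.

HB.instance Definition _ i :=
  GRing.isLinear.Build K dual dual *:%R (refl_fun i) (refl_fun_linear i).

Definition refl (i : I) : 'End(dual) := linfun (refl_fun i).

Lemma reflE i l : refl i l = l - l (coroot R i) *: simple_root R i.
Proof. by rewrite lfunE. Qed.

Lemma reflK i : (refl i \o refl i)%VF = \1%VF.
Proof.
apply/lfunP=> l; rewrite comp_lfunE id_lfunE !reflE !(add_lfunE, opp_lfunE).
rewrite scale_lfunE root_coroot gcm_diag.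
set c := l _; set r := simple_root R i.
rewrite -[c *: 2%:~R]/(c * 2%:~R) mulrDr mulr1 opprD addrA subrr add0r.
by rewrite scaleNr opprK subrK.
Qed.

(* The subgroup of GL(h^* ) generated by the simple reflections.               *)
Inductive is_weyl : 'End(dual) -> Prop :=
| is_weyl1 : is_weyl \1%VF
| is_weyl_refl i : is_weyl (refl i)
| is_weylM w1 w2 : is_weyl w1 -> is_weyl w2 -> is_weyl (w1 \o w2)%VF
| is_weylV w : is_weyl w -> is_weyl (w^-1)%VF.

Lemma is_weyl_lker0 w : is_weyl w -> lker w == 0%VS.
Proof.
elim=> {w} [|i|w1 w2 _ k1 _ k2|w _ kw].
- by apply/lker0P=> l m; rewrite !id_lfunE.
- apply/lker0P=> l m e.
  by rewrite -[l]id_lfunE -[m]id_lfunE -(reflK i) !comp_lfunE /= e.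
- apply/lker0P=> l m; rewrite !comp_lfunE.
  by move=> /(lker0P k1) /(lker0P k2).
- apply/lker0P=> l m e.
  by rewrite -[l]id_lfunE -[m]id_lfunE -(lker0_compfV kw) !comp_lfunE e.
Qed.

Definition in_weyl : {pred 'End(dual)} := fun w => `[< is_weyl w >].

Record weyl := Weyl { weyl_val : 'End(dual); _ : weyl_val \in in_weyl }.

HB.instance Definition _ := [isSub for weyl_val].
HB.instance Definition _ := [Choice of weyl by <:].

Lemma weylP (w : weyl) : is_weyl (weyl_val w).
Proof. by apply/asboolP; exact: valP w. Qed.

Definition weyl1 : weyl := Weyl (asboolT is_weyl1).
Definition weylM (w1 w2 : weyl) : weyl :=
  Weyl (asboolT (is_weylM (weylP w1) (weylP w2))).
Definition weylV (w : weyl) : weyl := Weyl (asboolT (is_weylV (weylP w))).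

Lemma weylA : associative weylM.
Proof. by move=> w1 w2 w3; apply: val_inj; rewrite /= comp_lfunA. Qed.
Lemma weyl1w : left_id weyl1 weylM.
Proof. by move=> w; apply: val_inj; rewrite /= comp_lfun1l. Qed.
Lemma weylw1 : right_id weyl1 weylM.
Proof. by move=> w; apply: val_inj; rewrite /= comp_lfun1r. Qed.
Lemma weylVw : left_inverse weyl1 weylV weylM.
Proof.
by move=> w; apply: val_inj; rewrite /= lker0_compVf // is_weyl_lker0 //; apply: weylP.
Qed.
Lemma weylwV : right_inverse weyl1 weylV weylM.
Proof.
by move=> w; apply: val_inj; rewrite /= lker0_compfV // is_weyl_lker0 //; apply: weylP.
Qed.

HB.instance Definition _ :=
  isGroup.Build weyl weylA weyl1w weylw1 weylVw weylwV.

Definition weyl_refl (i : I) : weyl := Weyl (asboolT (is_weyl_refl i)).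

Definition refl_word (s : seq I) : 'End(dual) :=
  foldr (fun i w => (refl i \o w)%VF) \1%VF s.

Lemma refl_word_cat s t :
  refl_word (s ++ t) = (refl_word s \o refl_word t)%VF.
Proof.
by elim: s => [|i s IH] /=; rewrite ?comp_lfun1l // IH comp_lfunA.
Qed.

Lemma refl_wordV s : (refl_word (rev s) \o refl_word s)%VF = \1%VF.
Proof.
elim: s => [|i s IH]; first by rewrite /= comp_lfun1l.
rewrite rev_cons -cats1 refl_word_cat /= comp_lfun1r -comp_lfunA.
by rewrite [(refl i \o (refl i \o _))%VF]comp_lfunA reflK comp_lfun1l.
Qed.

Lemma is_weyl_word w : is_weyl w -> exists s, w = refl_word s.
Proof.
elim=> {w} [|i|w1 w2 _ [s ->] _ [t ->]|w ww [s e]].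
- by exists [::].
- by exists [:: i]; rewrite /= comp_lfun1r.
- by exists (s ++ t); rewrite refl_word_cat.
exists (rev s); rewrite -[RHS]comp_lfun1r -(lker0_compfV (is_weyl_lker0 ww)).
by rewrite comp_lfunA {2}e refl_wordV comp_lfun1l.
Qed.

Lemma is_weight_weyl w l :
  is_weyl w -> l \in @is_weight K I A R -> w l \in @is_weight K I A R.
Proof.
move=> /is_weyl_word[s ->]; elim: s => [|i s IH] /= hl.
  by rewrite id_lfunE.
have /asboolP {}IH := IH hl; rewrite comp_lfunE reflE.
apply/asboolP=> k; have [[a ea] [b eb]] := (IH i, IH k).
exists (b - a * A k i); rewrite add_lfunE opp_lfunE scale_lfunE ea eb.
by rewrite root_coroot mulrzBr intrM.
Qed.

Definition weyl_act_weight (w : weyl) (l : weight R) : weight R :=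
  Weight (is_weight_weyl (weylP w) (valP l)).

(* The induced action on P'; independent of representatives by weyl_actE.      *)
Definition weyl_act (w : weyl) (l : weight' R) : weight' R :=
  to_weight' (weyl_act_weight w (repr l)).

Lemma weyl_actE (w : weyl) (l : weight R) :
  weyl_act w (to_weight' l) = to_weight' (weyl_act_weight w l).
Proof.
apply/eqP/to_weight'P; set m := repr _.
have /eqP/to_weight'P hm : to_weight' m = to_weight' l by exact: reprK.
have [s /= ->] := is_weyl_word (weylP w).
elim: s => [|i s IH] k /=; first by rewrite !id_lfunE hm.
by rewrite !comp_lfunE !reflE !add_lfunE !opp_lfunE !scale_lfunE !IH.
Qed.

End Weyl.

Arguments weyl_refl {K I A} R i.
Arguments simple_coroot {K I A} R i.

(* Main.v *)
(* Both P' lattices are faithfully coordinatized by the pairings with the simple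
   coroots, and in these coordinates psi multiplies the A-coordinate of the orbit
   O_i by kappa / o_i, on each j in O_i.  The reflections over an orbit act on the
   coordinates simultaneously by admissibility, so (2) for a simple reflection
   is the identity (kappa / o_k) a_ki = (kappa / o_i) sum_(j' in O_i) b_jj',
   j in O_k.  For (4), a coroot combination h is central iff every simple root
   kills it, and alpha_k = beta_j o phi for j in O_k because the orbit sums of the
   columns of B equal the entries of A. *)
Require Import Defs.
From HB Require Import structures.
From mathcomp Require Import all_boot all_order perm all_algebra.
From mathcomp Require Import boolp ring.

Set Implicit Arguments.
Unset Strict Implicit.
Unset Printing Implicit Defensive.

Import GRing.Theory Num.Theory.
Local Open Scope ring_scope.

(** * Coordinates on [weight'] and the Weyl action in them *)

Section Lattices.

Variables (K : fieldType) (I : finType) (A : gcm I) (R : realization K A).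
Implicit Types (x y : coroot_lattice R) (l m : weight' R).

Lemma to_weight'_repr l : to_weight' (repr l) = l.
Proof. exact: reprK. Qed.

Lemma coroot_lattice_val_sum (T : Type) (r : seq T) (P : pred T)
    (F : T -> coroot_lattice R) :
  coroot_lattice_val (\sum_(t <- r | P t) F t) =
    \sum_(t <- r | P t) coroot_lattice_val (F t).
Proof. exact: (raddf_sum \val). Qed.

Lemma coroot_lattice_val_mulz x (n : int) :
  coroot_lattice_val (x *~ n) = coroot_lattice_val x *~ n.
Proof. exact: (raddfMz \val). Qed.

Lemma pairing_suml (T : Type) (r : seq T) (P : pred T) F l :
  pairing (\sum_(t <- r | P t) F t) l = \sum_(t <- r | P t) pairing (F t) l.
Proof. by rewrite /pairing coroot_lattice_val_sum raddf_sum. Qed.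

Lemma pairing_mulzl x l (n : int) : pairing (x *~ n) l = pairing x l *~ n.
Proof. by rewrite /pairing coroot_lattice_val_mulz raddfMz. Qed.

(** [repr] need not be additive, so the difference is formed on classes and read off through
    [pairingE]. *)
Lemma pairing_is_zmod_morphism x : zmod_morphism (pairing x).
Proof.
move=> l m; rewrite -(to_weight'_repr l) -(to_weight'_repr m) /to_weight'.
rewrite -raddfB -!/(to_weight' _) !pairingE.
by rewrite /= add_lfunE opp_lfunE.
Qed.

HB.instance Definition _ x :=
  GRing.isZmodMorphism.Build (weight' R) K (pairing x)
    (pairing_is_zmod_morphism x).

Lemma weight'_inj l m :
  (forall i, pairing (simple_coroot R i) l = pairing (simple_coroot R i) m) ->
  l = m.
Proof.
rewrite -(to_weight'_repr l) -(to_weight'_repr m) => eq_lm.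
by apply/eqP/to_weight'P => i; have := eq_lm i; rewrite !pairingE.
Qed.

Lemma pairing_int x l : exists z : int, pairing x l = z%:~R.
Proof.
rewrite /pairing; case: x => x /= /asboolP[c ->].
have /asboolP/choice[z ez] := valP (repr l).
(* [c] expands the lattice element in simple coroots; [z] holds the integral values of the
   representative on them. *)
exists (\sum_i z i * c i); rewrite linear_sum rmorph_sum.
by apply: eq_bigr => i _; rewrite raddfMz /= ez intrM mulrzr.
Qed.

Lemma coroot_lattice_sum x :
  exists c : I -> int, x = \sum_i simple_coroot R i *~ c i.
Proof.
have /asboolP[c ec] := valP x; exists c; apply: val_inj.
rewrite /= ec coroot_lattice_val_sum.
by apply: eq_bigr => i _; rewrite coroot_lattice_val_mulz.
Qed.

(** Coordinates are integers, hence usable as coefficients; duality of [L] with the simple coroots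
    makes both sides agree in every coordinate. *)
Lemma weight'_sum (L : I -> weight R) (fundL : is_fundamental L) l :
  exists2 z : I -> int, forall i, pairing (simple_coroot R i) l = (z i)%:~R
    & l = \sum_i to_weight' (L i) *~ z i.
Proof.
have /choice[z ez] := fun i => pairing_int (simple_coroot R i) l.
exists z => //; apply: weight'_inj => k; rewrite ez raddf_sum (bigD1 k) //=.
rewrite raddfMz /= pairingE fundL eqxx big1 ?addr0 // => i /negPf nik.
by rewrite raddfMz /= pairingE fundL eq_sym nik mul0rz.
Qed.

Lemma weyl_act1 l : weyl_act 1%g l = l.
Proof.
rewrite -(to_weight'_repr l) weyl_actE; congr to_weight'.
by apply: val_inj; rewrite /= id_lfunE.
Qed.

Lemma weyl_actM (v w : weyl R) l :
  weyl_act (v * w)%g l = weyl_act v (weyl_act w l).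
Proof.
rewrite -(to_weight'_repr l) !weyl_actE; congr to_weight'.
by apply: val_inj; rewrite /= comp_lfunE.
Qed.

Lemma pairing_weyl_refl i k l :
  pairing (simple_coroot R k) (weyl_act (weyl_refl R i) l) =
    pairing (simple_coroot R k) l - pairing (simple_coroot R i) l * (A k i)%:~R.
Proof.
rewrite -(to_weight'_repr l) weyl_actE !pairingE /= reflE.
by rewrite add_lfunE opp_lfunE scale_lfunE root_coroot.
Qed.

(** The vanishing entries keep each reflection from changing the coordinates at the other indices of
    [s], so the corrections simply add up. *)
Lemma pairing_weyl_prod (s : seq I) k l :
    uniq s -> {in s &, forall i i', i != i' -> A i i' = 0} ->
  pairing (simple_coroot R k) (weyl_act (\prod_(i <- s) weyl_refl R i)%g l) =
    pairing (simple_coroot R k) l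
      - \sum_(i <- s) pairing (simple_coroot R i) l * (A k i)%:~R.
Proof.
elim: s k => [|a s IH] k; first by rewrite !big_nil weyl_act1 subr0.
move=> /andP[nas uniq_s] A0; have {}IH k' := IH k' uniq_s
  (sub_in2 (fun i (si : i \in s) => mem_behead (s := a :: s) si) A0).
rewrite !big_cons weyl_actM pairing_weyl_refl !IH.
rewrite [X in _ - (_ - X) * _]big1_seq ?subr0 => [|i /andP[_ si]].
  by rewrite opprD addrA addrAC.
rewrite (A0 a i) ?mulr0 ?inE ?eqxx ?si ?orbT //.
by apply: contraNneq nas => ->.
Qed.

(** Every element is a word in the reflections without inverses, so one can induct along the
    word. *)
Lemma weyl_ind (P : weyl R -> Prop) :
    P 1%g -> (forall i w, P w -> P (weyl_refl R i * w)%g) ->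
  forall w, P w.
Proof.
move=> P1 Prefl w; have [s] := is_weyl_word (weylP w).
elim: s w => [|i s IH] w ew; first by rewrite (_ : w = 1%g) //; apply: val_inj.
(* The inner factor cancels the first letter, leaving an element with the shorter word [s]. *)
rewrite (_ : w = weyl_refl R i * (weyl_refl R i * w))%g.
  apply/Prefl/IH; rewrite /= ew /=.
  by rewrite comp_lfunA reflK comp_lfun1l.
by apply: val_inj; rewrite /= comp_lfunA reflK comp_lfun1l.
Qed.

End Lattices.

(** * Centralizers in a Lie algebra *)

Section LieAlgebras.

Variables (K : fieldType) (g : lie_algebra K).
Implicit Types x y : g.

Lemma bracket0r x : bracket 0 x = 0.
Proof.
have := bracket_linear_l x (-1) 0 0.
by rewrite scaler0 addr0 scaleN1r addNr.
Qed.

Lemma bracketr0 x : bracket x 0 = 0.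
Proof.
have := bracket_linear_r x (-1) 0 0.
by rewrite scaler0 addr0 scaleN1r addNr.
Qed.

Lemma bracket_eq0_sym x y : bracket x y = 0 -> bracket y x = 0.
Proof.
move=> xy0; have := bracket_xx (x + y).
have := bracket_linear_l (x + y) 1 x y; rewrite !scale1r => ->.
have := bracket_linear_r x 1 x y; rewrite !scale1r => ->.
have := bracket_linear_r y 1 x y; rewrite !scale1r => ->.
by rewrite !bracket_xx xy0 addr0 addr0 add0r.
Qed.

(** Two of the three Jacobi terms vanish. With [km_gen], commuting with the generators then suffices
    for centrality. *)
Lemma centralizer_subalgebra x : is_subalgebra (fun y => bracket x y = 0).
Proof.
split; first split=> [|a y z xy xz]; first exact: bracketr0.
  by rewrite bracket_linear_r xy xz scaler0 addr0.
move=> y z xy xz; have := bracket_jacobi x y z.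
by rewrite xy (bracket_eq0_sym xz) !bracketr0 !addr0.
Qed.

End LieAlgebras.

(** * Central elements of the Cartan subalgebra *)

Section KacMoody.

Variables (K : fieldType) (I : finType) (A : gcm I) (R : realization K A).
Variable g : kac_moody R.

(** Otherwise the bracket of [km_e] and [km_f] at [i] would vanish, but it is the embedded coroot,
    nonzero by freeness and injectivity of [km_h]. *)
Lemma km_e_neq0 i : km_e g i != 0.
Proof.
apply/eqP => e0; have := km_ef g i i; rewrite eqxx e0 bracket0r.
rewrite -(raddf0 (km_h g)) => /km_h_inj/esym c0.
by have := free_not0 (coroot_free R) (codom_f _ i); rewrite c0 eqxx.
Qed.

Lemma km_h_center h :
  lie_center (km_h g h) <-> forall i, simple_root R i h = 0.
Proof.
split=> [h_center i | h0].
  have /eqP := km_he g h i; rewrite h_center eq_sym scaler_eq0.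
  by rewrite (negPf (km_e_neq0 i)) orbF => /eqP.
apply: (km_gen (centralizer_subalgebra (km_h g h))) => [h'|i|i].
- by rewrite km_hh.
- by rewrite km_he h0 scale0r.
- by rewrite km_hf h0 oppr0 scale0r.
Qed.

End KacMoody.

(** * Row and column sums of [B] over orbits *)

Section Orbits.

Variables (J : finType) (B : gcm J) (pi : {perm J}).
Variables (I : finType) (O : I -> {set J}) (orbO : indexes_orbits pi O).

Lemma orbit_porbit i j : j \in O i -> O i = porbit pi j.
Proof.
have /imsetP[k _ ->] : O i \in porbits pi by rewrite -orbO.2 imset_f.
by rewrite -eq_porbit_mem => /eqP.
Qed.

Lemma orbit_cover j : exists i, j \in O i.
Proof.
have /imsetP[i _ ei] : porbit pi j \in [set O i | i : I].
  by rewrite orbO.2 imset_f.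
by exists i; rewrite -ei porbit_id.
Qed.

Lemma orbit_ex i : exists j, j \in O i.
Proof.
have /imsetP[k _ ->] : O i \in porbits pi by rewrite -orbO.2 imset_f.
by exists k; rewrite porbit_id.
Qed.

Lemma orbit_card_gt0 i : (0 < #|O i|)%N.
Proof. by apply/card_gt0P; exact: orbit_ex. Qed.

Lemma orbit_card_neq0 i : #|O i|%:Z != 0.
Proof. by rewrite -[0]/(0%:Z) eqz_nat -lt0n orbit_card_gt0. Qed.

Lemma orbit_stable i j : (pi j \in O i) = (j \in O i).
Proof.
have /imsetP[k _ ->] : O i \in porbits pi by rewrite -orbO.2 imset_f.
by rewrite -!eq_porbit_mem; have := porbit_perm pi 1 j; rewrite expg1 => ->.
Qed.

Lemma dvdn_orbit_lcm i : (#|O i| %| orbit_lcm O)%N.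
Proof. by rewrite /orbit_lcm (bigD1 i) //= dvdn_lcml. Qed.

Variables (A : gcm I) (foldA : is_folding B O A).

Lemma folding_row i k j : j \in O k ->
  #|O i|%:Z * A k i = #|O k|%:Z * \sum_(j' in O i) B j j'.
Proof.
move=> Oj; apply: (@intr_inj rat); rewrite !intrM (foldA i Oj) rmorph_sum /=.
rewrite mulrCA mulrA; set S := \sum_(_ in _) _.
have: (#|O i|%:R : rat) != 0 by rewrite pnatr_eq0 -lt0n orbit_card_gt0.
by move=> ?; rewrite -!pmulrn; field.
Qed.

(** Multiplying by both orbit sizes turns each quotient into the lcm and leaves [folding_row]. *)
Lemma folding_row_lcm i k j : j \in O k ->
  (orbit_lcm O %/ #|O k|)%:Z * A k i =
    (orbit_lcm O %/ #|O i|)%:Z * \sum_(j' in O i) B j j'.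
Proof.
move=> /(folding_row i); set S := \sum_(_ in _) _ => e.
have kap a : #|O a|%:Z * (orbit_lcm O %/ #|O a|)%:Z = (orbit_lcm O)%:Z.
  by rewrite -PoszM mulnC divnK ?dvdn_orbit_lcm.
apply: (mulfI (orbit_card_neq0 k)); apply: (mulfI (orbit_card_neq0 i)); rewrite [X in _ * X]mulrA kap.
by rewrite mulrCA e [RHS]mulrCA [X in _ = _ * X]mulrA kap mulrCA.
Qed.

Hypothesis autB : gcm_automorphism B pi.

(** Substitute [pi j'] for [j']: this preserves the orbit, and [B] is invariant. *)
Lemma column_sum_perm i j : \sum_(j' in O i) B j' (pi j) = \sum_(j' in O i) B j' j.
Proof.
rewrite (reindex_inj (@perm_inj _ pi)) /=.
by apply: eq_big => [j' | j' _]; rewrite ?orbit_stable ?autB.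
Qed.

Lemma column_sum_orbit i k j j' : j \in O k -> j' \in O k ->
  \sum_(a in O i) B a j' = \sum_(a in O i) B a j.
Proof.
move=> Oj; rewrite (orbit_porbit Oj) => /porbitP[n ->].
by elim: n => [|n IH]; rewrite ?expg0 ?perm1 // expgSr permM column_sum_perm.
Qed.

(* Counting the entries of the block O_i x O_k of B by rows and by columns. *)
Lemma folding_column i k j : j \in O k -> \sum_(j' in O i) B j' j = A i k.
Proof.
move=> Oj; apply: (mulfI (orbit_card_neq0 k)); apply: (mulfI (orbit_card_neq0 i)).
transitivity (#|O i|%:Z * \sum_(a in O k) \sum_(b in O i) B b a).
  congr (_ * _); rewrite [RHS](eq_bigr (fun=> \sum_(b in O i) B b j)).
    by rewrite sumr_const -mulr_natl natz.
  by move=> a Oa; apply: column_sum_orbit Oj Oa.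
rewrite exchange_big mulr_sumr.
rewrite (eq_bigr (fun=> #|O k|%:Z * A i k)); last first.
  by move=> b Ob; rewrite (folding_row k Ob).
by rewrite sumr_const -mulr_natl natz.
Qed.

End Orbits.

Theorem theorem4p5 (K : fieldType) (charK0 : [pchar K] =i pred0)
    (J : finType) (B : gcm J) (pi : {perm J})
    (autB : gcm_automorphism B pi) (admB : admissible B pi)
    (I : finType) (O : I -> {set J}) (orbO : indexes_orbits pi O)
    (A : gcm I) (foldA : is_folding B O A)
    (RA : realization K A) (gA : kac_moody RA)
    (RB : realization K B) (gB : kac_moody RB)
    (Lambda : I -> weight RA) (fundA : is_fundamental Lambda)
    (omega : J -> weight RB) (fundB : is_fundamental omega)
    (psi : {additive weight' RA -> weight' RB})
    (psiE : forall i, psi (to_weight' (Lambda i))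
       = (\sum_(j in O i) to_weight' (omega j)) *+ (orbit_lcm O %/ #|O i|))
    (phi : {additive coroot_lattice RA -> coroot_lattice RB})
    (phiE : forall i, phi (simple_coroot RA i)
       = \sum_(j in O i) simple_coroot RB j)
    (f : {multiplicative weyl RA -> weyl RB})
    (fE : forall i, f (weyl_refl RA i) = (\prod_(j in O i) weyl_refl RB j)%g) :
  [/\ forall (x : coroot_lattice RA) (l : weight' RA),
        pairing (phi x) (psi l) = (orbit_lcm O)%:R * pairing x l,
      forall (l : weight' RA) (w : weyl RA),
        psi (weyl_act w l) = weyl_act (f w) (psi l),
      (forall (w : weyl RA) (l : weight' RA) (x : coroot_lattice RA),
        pairing (phi x) (weyl_act (f w) (psi l))
          = (orbit_lcm O)%:R * pairing x (weyl_act w l)) /\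
      (forall (w : weyl RA) (l : weight' RA) (i : I),
        pairing (\sum_(j in O i) simple_coroot RB j) (weyl_act (f w) (psi l))
          = (orbit_lcm O)%:R * pairing (simple_coroot RA i) (weyl_act w l))
    & forall x : coroot_lattice RA,
        lie_center (km_h gA (coroot_lattice_val x)) ->
        lie_center (km_h gB (coroot_lattice_val (phi x)))].
Proof.
set kappa := orbit_lcm O.
have psi_coord i j l : j \in O i -> pairing (simple_coroot RB j) (psi l) =
    (kappa %/ #|O i|)%:R * pairing (simple_coroot RA i) l.
  move=> Oj; have [z -> {1}->] := weight'_sum fundA l.
  rewrite !raddf_sum (bigD1 i) //= big1 ?addr0 => [|k nki].
    rewrite !raddfMz /= psiE raddfMn raddf_sum (bigD1 j) //= pairingE fundB eqxx.
    rewrite big1 ?addr0 => [|a /andP[_ naj]]; first by rewrite -mulrzr.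
    by rewrite pairingE fundB eq_sym (negPf naj).
  rewrite !raddfMz /= psiE raddfMn raddf_sum big1 ?mul0rn ?mul0rz // => a Oa.
  (* An index common to [O k] and [O i] would force equal orbits, against injectivity of [O]. *)
  rewrite /= pairingE fundB; case: eqP => // eja; case/eqP: nki; apply: orbO.1.
  by rewrite (orbit_porbit orbO Oa) (orbit_porbit orbO Oj) eja.
have pairing_phi x l : pairing (phi x) (psi l) = kappa%:R * pairing x l.
  have [c ->] := coroot_lattice_sum x.
  rewrite raddf_sum !pairing_suml mulr_sumr; apply: eq_bigr => i _.
  rewrite raddfMz !pairing_mulzl phiE pairing_suml mulrzAr.
  (* The summand is constant on [O i], and the orbit size times [kappa %/ #|O i|] is [kappa]. *)
  rewrite (eq_bigr _ (fun j => @psi_coord i j l)) sumr_const -mulrnAl -mulrnA.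
  by rewrite divnK ?dvdn_orbit_lcm.
have psi_refl i l :
    psi (weyl_act (weyl_refl RA i) l) = weyl_act (f (weyl_refl RA i)) (psi l).
  apply: weight'_inj => j; have [k Oj] := orbit_cover orbO j.
  (* The orbit product becomes one over a duplicate-free list; admissibility supplies the vanishing
     entries. *)
  rewrite (psi_coord k) // pairing_weyl_refl fE -big_filter.
  rewrite pairing_weyl_prod ?filter_uniq ?index_enum_uniq //; last first.
    move=> a b; rewrite !mem_filter => /andP[Oa _] /andP[Ob _] nab.
    by apply: admB; rewrite 1?eq_sym // -(orbit_porbit orbO Oa).
  rewrite big_filter (psi_coord k) // mulrBr; congr (_ - _).
  transitivity (\sum_(a in O i) (kappa %/ #|O i|)%:R
      * pairing (simple_coroot RA i) l * (B j a)%:~R); last first.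
    by apply: eq_bigr => a Oa; rewrite (psi_coord i).
  rewrite -mulr_sumr -rmorph_sum mulrCA [RHS]mulrAC -[RHS]mulrC.
  congr (_ * _); rewrite !pmulrn -!intrM; congr (_%:~R).
  exact: (folding_row_lcm orbO foldA i Oj).
have psi_weyl l w : psi (weyl_act w l) = weyl_act (f w) (psi l).
  elim/weyl_ind: w => [|i w IH].
    (* The image of the identity is idempotent, hence trivial by cancellation. *)
    have -> : f 1%g = 1%g by apply: (mulgI (f 1%g)); rewrite -gmulfM !mulg1.
    by rewrite !weyl_act1.
  by rewrite gmulfM !weyl_actM psi_refl IH.
split=> //.
- by split=> [w l x | w l i]; rewrite -psi_weyl -?phiE pairing_phi.
move=> x /km_h_center x_center; apply/km_h_center => j.
have [k Oj] := orbit_cover orbO j; rewrite -(x_center k).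
have [c ->] := coroot_lattice_sum x.
rewrite raddf_sum !coroot_lattice_val_sum !raddf_sum; apply: eq_bigr => i _.
rewrite raddfMz !coroot_lattice_val_mulz !raddfMz phiE coroot_lattice_val_sum.
rewrite raddf_sum; congr (_ *~ _).
(* Here a column sum is needed, since the root index [j] is fixed while the coroot index runs over
   [O i]. *)
rewrite /= root_coroot -(folding_column orbO foldA autB i Oj) rmorph_sum.
by apply: eq_bigr => a _; rewrite /= root_coroot.
Qed.
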